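(* Let $E$ be the following set of 177 nonnegative integers: $E=\{0, 2, 4, 7, 8, 11, 16, 17, 29, 92, 125, 154, 155, 174, 361, 390, 441, 473, 529, 564, 601, 637, 704, 742, 743, 783, 837, 1003, 1147, 1184, 1340, 1341, 1380, 1394, 1548, 1549, 1606, 1665, 1771, 1772, 1833, 1896, 2173, 2241, 2279, 2508, 2581, 2867, 2945, 3250, 3333, 3336, 3503, 3588, 3657, 3745, 3748, 3925, 4015, 4016, 4107, 4466, 4467, 4563, 4564, 4661, 5186, 5289, 5806, 5915, 6026, 6461, 6576, 6693, 6811, 7151, 7272, 7395, 7396, 7436, 7519, 8003, 8132, 8133, 8262, 8305, 9222, 9454, 10086, 10187, 10478, 11200, 11245, 11505, 12261, 12467, 12580, 12583, 12904, 13066, 13370, 13703, 13752, 14041, 14210, 14381, 15052, 15227, 15402, 15403, 15580, 15759, 16511, 17254, 17441, 17985, 18955, 19152, 19522, 20532, 20533, 20737, 21122, 21961, 22172, 22173, 22385, 22654, 22814, 23656, 23875, 23876, 24096, 24541, 24598, 26855, 28726, 28783, 28968, 30910, 31161, 33174, 33434, 35518, 35787, 36391, 37147, 39125, 39625, 39626, 39909, 41958, 44890, 47921, 50126, 51051, 53326, 53327, 53655, 56625, 56626, 56964, 61851, 65764, 66129, 69797, 70173, 73950, 74337, 78223, 78621, 108375, 114014, 129359, 136036, 142881, 149894\}$. Then for every integer $n \geq 0$ with $n \notin E$ (in particular, for every $n > 149{,}894$) we have \[ P(n) = f(n) + Q(g(n)) \qquad\text{and}\qquad Q(n) = 1 +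 f(n) + P(g(n)). \] Moreover, $f(n)$ and $g(n)$ are the smallest nonnegative integers satisfying $[1+2+\cdots+f(n)] - g(n) = n$.
   Context: For $A \subseteq \{0,1,2,\ldots\}$, the boundary of $A$ is $\partial A = \{z \in A : \{z-1,z+1\} \not\subseteq A\}$, the volume is $vol(A)=\sum_{z\in A} z$ and the perimeter is $per(A) = \sum_{z \in \partial A} z$ (both are $0$ for the empty set). The complement is $A^c = \{0,1,2,\ldots\}\setminus A$. For an integer $n\ge 0$, $P(n) = \min\{per(A) : A \subseteq \{0,1,\ldots\},\ vol(A)=n\}$ and $Q(n) = \min\{per(A^c) : A \subseteq \{0,1,\ldots\},\ vol(A) = n\}$. Define $f(n) = \lfloor \sqrt{2n} + 1/2\rfloor$ (the nearest integer to $\sqrt{2n}$) and $g(n) = f(n)(f(n)+1)/2 - n$. *)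

(* Defs.v *)
From Stdlib Require Import BinNat.
From mathcomp Require Import all_boot all_order all_algebra.
From mathcomp Require Import boolp classical_sets functions cardinality fsbigop.
From mathcomp Require Import reals.

Set Implicit Arguments.
Unset Strict Implicit.
Unset Printing Implicit Defensive.

Import Order.TTheory GRing.Theory Num.Theory.
Local Open Scope classical_set_scope.
Local Open Scope nat_scope.

(* The point [-1] is in no set of natural numbers: this is what [0 < z]
   accounts for, [z.-1] being the truncated predecessor. *)
Definition boundary (A : set nat) : set nat :=
  [set z | A z /\ ~ [/\ 0 < z, A z.-1 & A z.+1]].

(* [\big[addn/0]_(z \in A) _] is only meaningful for a finite index set [A]
   (it is [0] if [A] has infinitely many nonzero elements). Below, [vol] is
   applied to finite sets only, and [per] to finite and cofinite sets only,
   both of which have a finite boundary. *)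
Definition vol (A : set nat) : nat := \big[addn/0]_(z \in A) z.
Definition per (A : set nat) : nat := \big[addn/0]_(z \in boundary A) z.

(* The volume of an infinite set of natural numbers is infinite, so the sets
   of volume [n] are all finite. *)
Definition has_vol (A : set nat) (n : nat) : Prop := finite_set A /\ vol A = n.

Definition P_value (n m : nat) : Prop := exists2 A, has_vol A n & per A = m.
Definition Q_value (n m : nat) : Prop := exists2 A, has_vol A n & per (~` A) = m.

Lemma has_vol_set1 n : has_vol [set n] n.
Proof. by split; [exact: finite_set1 | rewrite /vol fsbig_set1]. Qed.

Lemma P_value_ex n : exists m, `[< P_value n m >].
Proof.
by exists (per [set n]); apply/asboolP; exists [set n] => //; exact: has_vol_set1.
Qed.

Lemma Q_value_ex n : exists m, `[< Q_value n m >].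
Proof.
by exists (per (~` [set n])); apply/asboolP; exists [set n] => //;
  exact: has_vol_set1.
Qed.

Definition P (n : nat) : nat := ex_minn (P_value_ex n).
Definition Q (n : nat) : nat := ex_minn (Q_value_ex n).

(* [Num.truncn x] is the floor of [x], as a natural number, for [0 <= x]. *)
Definition f (R : realType) (n : nat) : nat :=
  Num.truncn (Num.sqrt (2 * n)%N%:R + 1 / 2 : R)%R.

(* The division is exact. The subtraction of [nat] is truncated, but
   [n <= f n * (f n + 1) / 2] always holds. *)
Definition g (R : realType) (n : nat) : nat :=
  (f R n * (f R n + 1)) %/ 2 - n.

(* Binary literals, since the unary [nat] ones are too large to compute with. *)
Definition exceptions_bin : seq N := [::
  0; 2; 4; 7; 8; 11; 16; 17; 29; 92;
  125; 154; 155; 174; 361; 390; 441; 473; 529; 564;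
  601; 637; 704; 742; 743; 783; 837; 1003; 1147; 1184;
  1340; 1341; 1380; 1394; 1548; 1549; 1606; 1665; 1771; 1772;
  1833; 1896; 2173; 2241; 2279; 2508; 2581; 2867; 2945; 3250;
  3333; 3336; 3503; 3588; 3657; 3745; 3748; 3925; 4015; 4016;
  4107; 4466; 4467; 4563; 4564; 4661; 5186; 5289; 5806; 5915;
  6026; 6461; 6576; 6693; 6811; 7151; 7272; 7395; 7396; 7436;
  7519; 8003; 8132; 8133; 8262; 8305; 9222; 9454; 10086; 10187;
  10478; 11200; 11245; 11505; 12261; 12467; 12580; 12583; 12904; 13066;
  13370; 13703; 13752; 14041; 14210; 14381; 15052; 15227; 15402; 15403;
  15580; 15759; 16511; 17254; 17441; 17985; 18955; 19152; 19522; 20532;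
  20533; 20737; 21122; 21961; 22172; 22173; 22385; 22654; 22814; 23656;
  23875; 23876; 24096; 24541; 24598; 26855; 28726; 28783; 28968; 30910;
  31161; 33174; 33434; 35518; 35787; 36391; 37147; 39125; 39625; 39626;
  39909; 41958; 44890; 47921; 50126; 51051; 53326; 53327; 53655; 56625;
  56626; 56964; 61851; 65764; 66129; 69797; 70173; 73950; 74337; 78223;
  78621; 108375; 114014; 129359; 136036; 142881; 149894]%num.

Definition exceptions : seq nat := [seq nat_of_bin k | k <- exceptions_bin].

Lemma exceptions_bin_uniq_size : uniq exceptions_bin && (size exceptions_bin == 177).
Proof. by vm_compute. Qed.

(* Main.v *)
Require Import Defs.
From Stdlib Require Import BinNat Nnat FMapPositive.
From mathcomp Require Import all_boot all_order all_algebra.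
From mathcomp Require Import boolp classical_sets cardinality fsbigop.
From mathcomp Require Import reals.
From mathcomp Require Import zify lra.

(* If m is the largest element of A and B = {0, ..., m} \ A, then A^c has
   perimeter m + 1 + per(B), and A has perimeter m + per(B^c) unless m - 1 is
   in B, in which case it has perimeter m + per(A \ {m}).  With F = f(n) and
   g = g(n), the choice m = F gives P(n) <= F + Q(g) and Q(n) <= 1 + F + P(g)
   for all n.  For m = F + k with k > 0 the set B has volume
   g + kF + k(k+1)/2, and the reverse inequalities amount to
   Q(g) <= k + per(B^c) and P(g) <= k + per(B).

   As g < F, the trivial bounds per(B) >= f(vol B) and
   per(B^c) >= 1 + f(vol B) are enough when g >= 1100, given the estimates
   4P(j), 4Q(j) <= 32 + j.  For g < 1100 we use exact values of P and Q below
   1100.  They are computed by dynamic programming; that they are lower bounds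
   follows, by induction on the largest element, from inequalities between
   table entries that are checked by computation.  When g < 1100, only finitely
   many F are out of reach of the trivial bounds; for these the inequalities
   are also checked by computation, and fail only at exceptions. *)

Set Implicit Arguments.
Unset Strict Implicit.
Unset Printing Implicit Defensive.

Import Order.TTheory GRing.Theory Num.Theory.
Local Open Scope classical_set_scope.
Local Open Scope nat_scope.

(** * Reflecting a set in an initial segment *)

Definition tri m := (m * m.+1)./2.

Lemma double_tri m : 2 * tri m = m * m.+1.
Proof. by rewrite mul2n /tri even_halfK// oddM oddS andbN. Qed.

Lemma triS m : tri m.+1 = tri m + m.+1.
Proof. have := double_tri m; have := double_tri m.+1; lia. Qed.

Lemma leq_tri : {homo tri : m n / m <= n}.
Proof. by apply: homo_leq => // [? ? ? /leq_trans|m]; [exact | rewrite triS leq_addr]. Qed.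

Lemma finite_below m (X : set nat) : X `<=` `I_m -> finite_set X.
Proof. by move=> /sub_finite_set; apply; exact: finite_II. Qed.

Lemma volU (X Y : set nat) : finite_set X -> finite_set Y ->
  X `&` Y `<=` set0 -> vol (X `|` Y) = vol X + vol Y.
Proof. exact: fsbigU0. Qed.

Lemma vol_set1 m : vol [set m] = m.
Proof. exact: fsbig_set1. Qed.

Lemma vol_set0 : vol set0 = 0.
Proof. exact: fsbig_set0. Qed.

Lemma vol_subset (X Y : set nat) : finite_set Y -> X `<=` Y -> vol X <= vol Y.
Proof.
move=> finY XY; rewrite -(setDUK XY) volU ?leq_addr//.
- exact: sub_finite_set finY.
- exact: finite_setD.
- by move=> z [Xz [_ /(_ Xz)]].
Qed.

Lemma vol_II m : vol `I_m.+1 = tri m.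
Proof.
elim: m => [|m IHm].
  by rewrite IIS II0 set0U vol_set1.
rewrite IIS volU ?IHm ?vol_set1 ?triS//.
by move=> z [/= zm zE]; rewrite zE ltnn in zm.
Qed.

Lemma leq_vol (X : set nat) m : finite_set X -> X m -> m <= vol X.
Proof. by move=> finX Xm; rewrite -{1}(vol_set1 m); apply: vol_subset => // _ ->. Qed.

Lemma perE X : per X = vol (boundary X).
Proof. by []. Qed.

Lemma boundary_below m (X : set nat) : X `<=` `I_m -> boundary X `<=` `I_m.
Proof. by move=> Xm z [/Xm]. Qed.

Lemma boundary_setC_below m (X : set nat) :
  X `<=` `I_m -> boundary (~` X) `<=` `I_m.+1.
Proof.
move=> Xm z [nXz bz]; rewrite /= ltnS leqNgt; apply/negP => mz; apply: bz.
by split=> [|/Xm|/Xm] /=; lia.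
Qed.

Lemma boundary_congr (X Y : set nat) z : (forall y, y <= z.+1 -> X y <-> Y y) ->
  boundary X z <-> boundary Y z.
Proof.
move=> XY; rewrite /boundary /=.
suff [-> -> ->] : [/\ X z = Y z, X z.-1 = Y z.-1 & X z.+1 = Y z.+1] by [].
by split; apply/propext/XY; lia.
Qed.

Definition flip m (B : set nat) := `I_m.+1 `\` B.

Lemma flipP m B z : flip m B z <-> z <= m /\ ~ B z.
Proof. by rewrite /flip /= ltnS. Qed.

Lemma flip_below m B : flip m B `<=` `I_m.+1.
Proof. by move=> z []. Qed.

Lemma vol_flip m B : B `<=` `I_m -> vol (flip m B) + vol B = tri m.
Proof.
move=> Bm; rewrite -vol_II addnC -volU.
- by congr vol; apply: setDUK => z /Bm /= /ltnW.
- exact: finite_below Bm.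
- exact/finite_setD/finite_II.
- by move=> z [Bz [_ /(_ Bz)]].
Qed.

(** The complement of [flip m B] is [B] together with everything above [m]. The missing point [m]
    separates the two pieces, so only [m + 1] joins the boundary of [B]. *)
Lemma per_setC_flip m B : B `<=` `I_m ->
  per (~` flip m B) = m.+1 + per B.
Proof.
move=> Bm; have BmN z : m <= z -> ~ B z by move=> mz /Bm /=; lia.
have ltb z : z < m -> boundary (~` flip m B) z <-> boundary B z.
  move=> zm; apply: boundary_congr => y yz.
  split=> [/= nA|By /flipP [_ /(_ By)]//].
  by apply: contrapT => nB; apply/nA/flipP; split=> //; lia.
rewrite !perE.
have -> : boundary (~` flip m B) = boundary B `|` [set m.+1].
  apply/seteqP; split=> z.
    move=> bz; have /= := boundary_setC_below (@flip_below m B) bz.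
    case: (ltngtP z m) => [zm|mz|zm] zm2.
    - by left; apply/ltb.
    - by right => /=; lia.
    - by case: bz => /= + _; case; apply/flipP; rewrite zm; split=> //; exact: BmN.
  move=> [bz|->].
    by apply/ltb => //; case: bz => /Bm.
  split=> [/flipP [] | [_ /= nA _]]; first by rewrite ltnn.
  by apply/nA/flipP; split=> //; exact: BmN.
rewrite volU ?vol_set1 1?addnC//.
- exact/finite_below/(boundary_below Bm).
- by move=> z [[/Bm /= zm _] zE]; lia.
Qed.

Lemma boundary_flip m B z : B `<=` `I_m -> z < m ->
  boundary (flip m B) z <-> boundary (~` B) z.
Proof.
move=> Bm zm; apply: boundary_congr => y yz.
by rewrite flipP /=; split=> [[]|]//; split=> //; lia.
Qed.

Lemma boundary_flip_max m B : B `<=` `I_m -> boundary (flip m B) m.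
Proof.
move=> Bm; split=> [|[_ _ /flipP [] ]]; last by rewrite ltnn.
by apply/flipP; split=> // /Bm /=; rewrite ltnn.
Qed.

(** The two boundaries agree below [m]. Equality can fail because [m] may already be a boundary
    point of the complement of [B]. *)
Lemma per_flip m B : B `<=` `I_m -> per (flip m B) <= m + per (~` B).
Proof.
move=> Bm; rewrite -[m in m + _]vol_set1.
have finB := finite_below (boundary_setC_below Bm).
apply: leq_trans (_ : vol ([set m] `|` (boundary (~` B) `\ m)) <= _).
  apply: vol_subset.
    by rewrite finite_setU; split=> //; exact: finite_setD.
  move=> z bz; have := boundary_below (@flip_below m B) bz.
  rewrite /= ltnS leq_eqVlt => /predU1P [|zm]; first by left.
  by right; split; [apply/(boundary_flip Bm) | move=> /= zE; rewrite zE ltnn in zm].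
rewrite volU ?leq_add2l//; first exact: vol_subset.
  exact: finite_setD.
by move=> z [zm [_ /(_ zm)]].
Qed.

(** For [m > 0], the points [m - 1], [m] and [m + 1] all avoid [B], so [m] is interior to the
    complement and is not counted twice. *)
Lemma per_flip_notin m B : B `<=` `I_m -> ~ B m.-1 ->
  m + per (~` B) <= per (flip m B).
Proof.
move=> Bm nB; have bB := boundary_setC_below Bm.
case: m Bm nB bB => [|m] Bm nB bB.
  (* Here [m] is [0], and a boundary inside [{0}] has volume [0]. *)
  by rewrite add0n (leq_trans (vol_subset (finite_II 1) bB)) ?vol_II.
have nbB : ~ boundary (~` B) m.+1.
  by move=> [_]; apply; split=> // /Bm /=; lia.
rewrite -[X in X + _]vol_set1 addnC -volU//; last by move=> z [bz zm]; rewrite zm in bz.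
  apply: vol_subset; first exact/finite_below/boundary_below/flip_below.
  move=> z [bz|->]; last exact: boundary_flip_max.
  apply/(boundary_flip Bm) => //.
  have := bB z bz; rewrite /= ltnS leq_eqVlt => /predU1P [zE|//].
  by rewrite zE in bz.
exact: finite_below bB.
Qed.

Lemma eq_flip_max m (A : set nat) : A `<=` `I_m.+1 -> A m ->
  exists2 B, B `<=` `I_m & A = flip m B.
Proof.
move=> Am mA; exists (`I_m `\` A); first by move=> z [].
apply/seteqP; split=> z.
  by move=> Az; split; [exact: Am | move=> []].
move=> [/= zm nBz]; apply: contrapT => nAz; apply: nBz; split=> //=.
have : z != m by apply/eqP => zE; case: nAz; rewrite zE.
by lia.
Qed.

Lemma vol_setU_max m (C : set nat) : C `<=` `I_m.-1 ->
  vol (C `|` [set m]) = m + vol C.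
Proof.
move=> Cm; rewrite volU ?vol_set1 1?addnC//; first exact: finite_below Cm.
by move=> z [/Cm /= zm zE]; lia.
Qed.

(** All elements of [C] are below [m - 1], so [m] has no neighbour in [C]: it is a boundary point
    and changes no other. *)
Lemma per_setU_max m (C : set nat) : C `<=` `I_m.-1 ->
  per (C `|` [set m]) = m + per C.
Proof.
move=> Cm; rewrite !perE addnC.
rewrite -[X in _ = _ + X]vol_set1 -volU //.
- congr vol; apply/seteqP; split=> z.
    move=> [[Cz|->] bz]; last by right.
    left; split=> // -[z0 Cz1 Cz2]; apply: bz; split=> //; by left.
  move=> [[Cz bz]|->].
    split; first by left.
    have /= zm := Cm _ Cz; move=> [z0 Cz1 Cz2]; apply: bz.
    by split=> //; [case: Cz1 | case: Cz2] => //= zE; lia.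
  split; first by right.
  by move=> [_ _ [/Cm|]] /= mm; lia.
- exact/finite_below/(boundary_below Cm).
- by move=> z [[/Cm /= zm _] zE]; lia.
Qed.

Lemma flip_decomp m (A : set nat) : A `<=` `I_m.+1 -> A m ->
  exists B, [/\ vol A + vol B = tri m, B `<=` `I_m, per (~` A) = m.+1 + per B
    & m + per (~` B) <= per A \/
      exists C, [/\ C `<=` `I_m.-1, vol A = m + vol C & per A = m + per C]].
Proof.
move=> Am mA; have [B Bm AE] := eq_flip_max Am mA.
exists B; rewrite AE; split=> //; [exact: vol_flip | exact: per_setC_flip |].
have [Bm1|nBm1] := pselect (B m.-1); last by left; exact: per_flip_notin.
right; exists (A `\ m).
have Cm : A `\ m `<=` `I_m.-1.
  move=> z [Az /= /eqP zm]; have := Am _ Az; rewrite /= => zm1.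
  have : z != m.-1 by apply/eqP => zE; move: Az; rewrite AE zE => -[].
  by lia.
rewrite -AE -(vol_setU_max Cm) -(per_setU_max Cm).
suff -> : A `\ m `|` [set m] = A by [].
by rewrite setUC setD1K.
Qed.

Lemma ex_max (A : set nat) : finite_set A -> 0 < vol A ->
  exists2 m, A `<=` `I_m.+1 & A m.
Proof.
move=> finA A0.
have : A `<=` `I_(vol A).+1 by move=> z /(leq_vol finA).
elim: (vol A).+1 => [|m IHm] Am.
  by move: A0; rewrite (_ : A = set0) ?vol_set0// -subset0 -(II0); exact: Am.
have [mA|nmA] := pselect (A m); first by exists m.
apply: IHm => z Az; have /= := Am z Az.
have : z != m by apply/eqP => zE; apply: nmA; rewrite -zE.
by lia.
Qed.

(** * A certified table of values *)

Definition triN (m : N) : N := N.div2 (m * N.succ m).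

(* For a volume n, [pval] and [qval] are meant to be [P n] and [Q n]; they are
   attained by sets with all elements below [pbound] and [qbound]. *)
Record entry := Entry {pval : N; pbound : N; qval : N; qbound : N}.

Definition lookup (t : PositiveMap.t entry) (n : N) : entry :=
  if PositiveMap.find (N.succ_pos n) t is Some e then e else Entry 0 0 0 0.

Definition table_size : N := 1100.

Definition smaller (a b : N * N) := if (a.1 <? b.1)%num then a else b.

(* The offers made by the sets of volume [n] with largest element [m]. The second
   one for [P] is the union of [m] and a set with all elements below [m - 1]. *)
Definition improve t n (pq : (N * N) * (N * N)) (m : N) :=
  let x := (triN m - n)%num in
  let e := lookup t x in
  let c := lookup t (n - m) in
  let p := if ((x <? n) && (qbound e <=? m))%num
           then smaller (m + qval e, m + 1)%num pq.1 else pq.1 in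
  let p := if ((m <=? n) && (0 <? m) && (pbound c <? m))%num
           then smaller (m + pval c, m + 1)%num p else p in
  let q := if ((x <? n) && (pbound e <=? m))%num
           then smaller (m + 1 + pval e, m + 1)%num pq.2 else pq.2 in
  (p, q).

(** After its update, [m] is the least number with [n <= triN m], that is [f n]. The start value
    [3 * n] is above every optimum, since [{n}] gives [P n <= n] and [Q n <= 2 * n]. *)
Fixpoint build (k : nat) (n m : N) (t : PositiveMap.t entry) :=
  if k is k'.+1 then
    let m := if (triN m <? n)%num then N.succ m else m in
    let pq := foldl (improve t n) ((3 * n, 0), (3 * n, 0))%num
                [seq m + i | i <- [:: 0; 1; 2; 3; 4; 5]]%num in
    build k' (N.succ n) m
      (PositiveMap.add (N.succ_pos n)
         (Entry pq.1.1 pq.1.2 pq.2.1 pq.2.2) t)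
  else t.

(* Largest elements from [f n] to [f n + 5] are enough to reach [P n] and [Q n].
   Only the checks below, not this computation, are proved correct. *)
Definition table : PositiveMap.t entry :=
  Eval vm_compute in
  build 1099 1 0 (PositiveMap.add xH (Entry 0 0 0 0) (PositiveMap.empty entry)).

Definition tab := lookup table.

(* [lower_P v x] and [lower_Q v x] certify that [v <= per A] and
   [v <= per (~` A)] for all [A] of volume [x], by the table if possible and by
   the trivial bounds beyond it. *)
Definition lower_P (v x : N) : bool :=
  if (x <? table_size)%num then (v <=? pval (tab x))%num
  else (triN (v - 1) <? x)%num.

Definition lower_Q (v x : N) : bool :=
  if (x <? table_size)%num then (v <=? qval (tab x))%num
  else (triN (v - 2) <? x)%num.

Fixpoint all_from (P : N -> bool) (i : N) (k : nat) : bool :=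
  if k is k'.+1 then P i && all_from P (N.succ i) k' else true.

(* From the largest element [maxn p q] on, the trivial bound is enough. *)
Definition check_lower (n : N) : bool :=
  let p := pval (tab n) in
  let q := qval (tab n) in
  all_from (fun m => let x := (triN m - n)%num in
      (triN m <? n)%num
      || [&& lower_Q (p - m) x, lower_P (q - 1 - m) x
           & (n <? m)%num || lower_P (p - m) (n - m)])
    0 (N.to_nat (N.max p q)).

(** The largest element of a recorded set is read off as its bound minus one. For [P] the set is a
    flip, or its maximum is isolated and the rest has volume [n - m]; for [Q] it is a flip. The last
    two conjuncts start the induction in [PQ_linear]. *)
Definition check_upper (n : N) : bool :=
  let e := tab n in
  let m := (pbound e - 1)%num in
  let x := (triN m - n)%num in
  let m' := (qbound e - 1)%num in
  let x' := (triN m' - n)%num in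
  [&& [|| [&& n <=? triN m, x <? n, qbound (tab x) <=? m
            & m + qval (tab x) <=? pval e]
        | [&& m <=? n, n - m <? n, pbound (tab (n - m)) <? m
            & m + pval (tab (n - m)) <=? pval e]],
    n <=? triN m', x' <? n, pbound (tab x') <=? m', m' + 1 + pval (tab x') <=? qval e,
    4 * pval e <=? 32 + n & 4 * qval e <=? 32 + n]%num.

(** Here [k] is the excess of the largest element over [F], and [x] the volume of the reflected set.
    The second test for each [k] concerns an isolated largest element, where the remaining set has
    volume [n - F - k]. *)
Definition check_pair (g F : N) : bool :=
  let p := pval (tab g) in
  let q := qval (tab g) in
  let n := (triN F - g)%num in
  all_from (fun k => let x := (g + k * F + triN k)%num in
      ((k =? 0)%num || lower_Q (q - k) x && lower_P (p - k) x)
      && [|| q + 2 <=? F, n <? F + k | lower_P (q - k) (n - F - k)]%num)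
    0 (N.to_nat (N.max p q))
  || has (N.eqb n) exceptions_bin.

(* For [F] greater than [lim - g], the trivial bounds are enough for all [k]. *)
Definition check_gap (g : N) : bool :=
  let p := pval (tab g) in
  let q := qval (tab g) in
  let lim := N.max (N.max (triN (q - 3)) (triN (p - 2))) (g + q + 1) in
  all_from (check_pair g) (g + 1) (N.to_nat (lim - g - g)).

Lemma check_lower_table : all_from check_lower 0 1100.
Proof. by vm_compute. Qed.

Lemma check_upper_table : all_from check_upper 1 1099.
Proof. by vm_compute. Qed.

Lemma check_gap_table : all_from check_gap 0 1100.
Proof. by vm_compute. Qed.

(** * Soundness of the computed checks *)

Lemma all_fromP P i k (j : N) : all_from P i k ->
  (i <= j)%num -> N.to_nat j < N.to_nat i + k -> P j.
Proof.
elim: k i => [|k IHk] i /=; first by lia.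
move=> /andP [Pi /IHk allP] ij jk.
have [<-//|ji] := N.eq_dec i j.
by apply: allP; lia.
Qed.

Lemma triN_tri m k : N.to_nat m = k -> N.to_nat (triN m) = tri k.
Proof.
move=> <-; have := double_tri (N.to_nat m); have := N.div2_odd (m * N.succ m).
rewrite /triN; move: (N.div2 _) (N.odd _) => x b.
have : (N.b2n b <= 1)%num by case: b.
by move: (N.b2n b) => c; lia.
Qed.

Lemma triD a b : tri (a + b) = tri a + a * b + tri b.
Proof. by have := double_tri (a + b); have := double_tri a; have := double_tri b; nia. Qed.

Lemma lt_tri m n : tri m < tri n -> m < n.
Proof. by move=> mn; rewrite ltnNge; apply/negP => /leq_tri; lia. Qed.

Lemma per_ge m (A : set nat) : A `<=` `I_m.+1 -> A m ->
  m <= per A /\ m < per (~` A).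
Proof.
move=> Am mA; have [B [_ _ -> [perA|[C [_ _ perA]]]]] := flip_decomp Am mA; lia.
Qed.

(** A set of volume exceeding [tri s] does not fit in [{0, ..., s}], so its maximum exceeds [s]. *)
Lemma per_gt_tri s (A : set nat) : finite_set A -> tri s < vol A ->
  s < per A /\ s.+1 < per (~` A).
Proof.
move=> finA sA; have [|m Am mA] := ex_max finA; first by lia.
have [B [volB _ _ _]] := flip_decomp Am mA.
have : s < m by apply: lt_tri; lia.
have := per_ge Am mA; lia.
Qed.

Lemma check_lower_tab (n : N) : (n <? table_size)%num -> check_lower n.
Proof.
move=> nN; apply: (all_fromP check_lower_table); first by lia.
by move: nN; rewrite /table_size; lia.
Qed.

(** Both bounds are proved together because reflection exchanges them; the induction applies since
    the reflected set lies strictly below the maximum. *)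
Lemma lower_sound M (A : set nat) : A `<=` `I_M -> forall v,
  (lower_P v (N.of_nat (vol A)) -> N.to_nat v <= per A) /\
  (lower_Q v (N.of_nat (vol A)) -> N.to_nat v <= per (~` A)).
Proof.
elim: M A => [|m IHm] A Am v.
  have -> : A = set0 by rewrite -subset0 -II0; exact: Am.
  (* At volume [0] both checks convert to [v <=? 0]. *)
  by rewrite vol_set0; split=> v0; have {v0} : (v <=? 0)%num := v0; lia.
have [mA|nmA] := pselect (A m); last first.
  apply: IHm => z Az; have /= := Am z Az.
  have : z != m by apply/eqP => zE; apply: nmA; rewrite -zE.
  by lia.
have [B [volB Bm perCA perA]] := flip_decomp Am mA.
have [mperA mperCA] := per_ge Am mA.
have [nN|Nn] := boolP (N.of_nat (vol A) <? table_size)%num; last first.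
  rewrite /lower_P /lower_Q (negbTE Nn); split=> vA.
    have : N.to_nat v - 1 < m by apply: lt_tri; have := @triN_tri (v - 1) (N.to_nat v - 1); lia.
    lia.
  have : N.to_nat v - 2 < m by apply: lt_tri; have := @triN_tri (v - 2) (N.to_nat v - 2); lia.
  lia.
suff [lowpA lowqA] : N.to_nat (pval (tab (N.of_nat (vol A)))) <= per A /\
    N.to_nat (qval (tab (N.of_nat (vol A)))) <= per (~` A).
  by rewrite /lower_P /lower_Q nN; lia.
have [pqm|mpq] := leqP (N.to_nat (N.max (pval (tab (N.of_nat (vol A))))
                           (qval (tab (N.of_nat (vol A)))))) m.
  by lia.
have := @all_fromP _ _ _ (N.of_nat m) (check_lower_tab nN) ltac:(lia) ltac:(lia).
have triNm := triN_tri (Nat2N.id m).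
have -> : (triN (N.of_nat m) - N.of_nat (vol A))%num = N.of_nat (vol B) by lia.
move=> /orP [|/and3P [/(proj2 (IHm _ Bm _)) pB /(proj1 (IHm _ Bm _)) qB pC]]; first by lia.
split; last by lia.
case: perA => [perA|[C [Cm volC perC]]]; first by lia.
have Cm' : C `<=` `I_m by move=> z /Cm /=; lia.
case/orP: pC; first by lia.
have -> : (N.of_nat (vol A) - N.of_nat m)%num = N.of_nat (vol C) by lia.
by move=> /(proj1 (IHm _ Cm' _)); lia.
Qed.

Lemma lower_P_sound v (A : set nat) : finite_set A ->
  lower_P v (N.of_nat (vol A)) -> N.to_nat v <= per A.
Proof. by move=> finA; apply: (proj1 (@lower_sound (vol A).+1 A _ v)) => z /(leq_vol finA). Qed.

Lemma lower_Q_sound v (A : set nat) : finite_set A ->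
  lower_Q v (N.of_nat (vol A)) -> N.to_nat v <= per (~` A).
Proof. by move=> finA; apply: (proj2 (@lower_sound (vol A).+1 A _ v)) => z /(leq_vol finA). Qed.

(** * The recursion *)

Lemma P_le A n : has_vol A n -> P n <= per A.
Proof.
by move=> An; rewrite /P; case: ex_minnP => p _; apply; apply/asboolP; exists A.
Qed.

Lemma Q_le A n : has_vol A n -> Q n <= per (~` A).
Proof.
by move=> An; rewrite /Q; case: ex_minnP => p _; apply; apply/asboolP; exists A.
Qed.

Lemma P_attained n : exists2 A, has_vol A n & per A = P n.
Proof. by rewrite /P; case: ex_minnP => p /asboolP. Qed.

Lemma Q_attained n : exists2 A, has_vol A n & per (~` A) = Q n.
Proof. by rewrite /Q; case: ex_minnP => p /asboolP. Qed.

Lemma has_vol_flip m B n : B `<=` `I_m -> n + vol B = tri m ->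
  has_vol (flip m B) n.
Proof.
move=> Bm nB; split; first exact/finite_below/flip_below.
by have := vol_flip Bm; lia.
Qed.

Lemma has_vol_below A n m : has_vol A n -> n < m -> A `<=` `I_m.
Proof. by move=> [finA <-] nm z /(leq_vol finA) /= zA; lia. Qed.

Lemma PQ_le_flip m n x : n + x = tri m -> x < m ->
  P n <= m + Q x /\ Q n <= m.+1 + P x.
Proof.
move=> nx xm; have [A Ax <-] := Q_attained x; have [B Bx <-] := P_attained x.
have Am := has_vol_below Ax xm; have Bm := has_vol_below Bx xm.
split.
  apply: leq_trans (per_flip Am); apply: P_le.
  by apply: has_vol_flip => //; rewrite Ax.2.
rewrite -(per_setC_flip Bm); apply: Q_le.
by apply: has_vol_flip => //; rewrite Bx.2.
Qed.

(** Strong induction on the volume. The bounds are carried along so that the smaller set is known to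
    lie below the new maximum. *)
Lemma upper_sound n : n < 1100 -> let e := tab (N.of_nat n) in
  (exists A, [/\ A `<=` `I_(N.to_nat (pbound e)), has_vol A n
               & per A <= N.to_nat (pval e)]) /\
  (exists A, [/\ A `<=` `I_(N.to_nat (qbound e)), has_vol A n
               & per (~` A) <= N.to_nat (qval e)]).
Proof.
elim/ltn_ind: n => n IHn nN /=; have [->|n0] := posnP n.
  have vol0 : has_vol set0 0 by split; [exact: finite_set0 | exact: vol_set0].
  have per0 : per set0 = 0.
    by rewrite perE (_ : boundary set0 = set0) ?vol_set0// -subset0 => z [].
  have perT : per (~` set0) = 0.
    have I0 : set0 `<=` `I_0 by [].
    apply/eqP; rewrite -leqn0.
    by have := vol_subset (finite_II 1) (boundary_setC_below I0); rewrite vol_II.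
  by split; exists set0; split; rewrite ?per0 ?perT//; exact: sub0set.
have := @all_fromP _ _ _ (N.of_nat n) check_upper_table ltac:(lia) ltac:(lia).
rewrite /check_upper; set e := tab (N.of_nat n).
move=> /and5P [cP nm' x'n b' /and3P [c' _ _]]; split; last first.
  have triNm := @triN_tri (qbound e - 1) _ erefl.
  move: nm' x'n b' c' triNm; set m := N.to_nat (qbound e - 1).
  have -> : (triN (qbound e - 1) - N.of_nat n)%num =
    N.of_nat (N.to_nat (triN (qbound e - 1)) - n) by lia.
  set x := _ - n => nm xn b c triNm.
  have [[B [Bb Bx perB]] _] := IHn x ltac:(lia) ltac:(lia).
  have Bm : B `<=` `I_m by move=> z /Bb /=; lia.
  (* With [m] positive, the truncated subtraction [qbound e - 1] is exact. *)
  have m0 : 0 < m by have := double_tri m; lia.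
  exists (flip m B); split.
  - by move=> z /flip_below /=; lia.
  - by apply: has_vol_flip; rewrite ?Bx.2//; lia.
  - by rewrite per_setC_flip//; lia.
have triNm := @triN_tri (pbound e - 1) _ erefl.
case/orP: cP => /and4P []; last first.
  set m := N.to_nat (pbound e - 1) in triNm *.
  have -> : (N.of_nat n - (pbound e - 1))%num = N.of_nat (n - m) by lia.
  move=> mn xn b c.
  have [[B [Bb Bx perB]] _] := IHn (n - m) ltac:(lia) ltac:(lia).
  have Bm : B `<=` `I_m.-1 by move=> z /Bb /=; lia.
  exists (B `|` [set m]); split.
  - by move=> z [/Bm|->] /=; lia.
  - split; last by rewrite vol_setU_max// Bx.2; lia.
    by rewrite finite_setU; split=> //; exact: finite_below Bm.
  - by rewrite per_setU_max//; lia.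
move: triNm; set m := N.to_nat (pbound e - 1).
have -> : (triN (pbound e - 1) - N.of_nat n)%num =
  N.of_nat (N.to_nat (triN (pbound e - 1)) - n) by lia.
set x := _ - n => triNm nm xn b c.
have [_ [B [Bb Bx perB]]] := IHn x ltac:(lia) ltac:(lia).
have Bm : B `<=` `I_m by move=> z /Bb /=; lia.
have m0 : 0 < m by have := double_tri m; lia.
exists (flip m B); split.
- by move=> z /flip_below /=; lia.
- by apply: has_vol_flip; rewrite ?Bx.2//; lia.
- by have := per_flip Bm; lia.
Qed.

(** * Linear upper bounds and comparison of largest elements *)

Lemma ex_tri_root n : 0 < n -> exists m x, x <= m /\ n + x = tri m.+1.
Proof.
move=> n0; have nex : exists m, n <= tri m.
  by exists n; have := double_tri n; nia.
case: (ex_minnP nex) => -[|m] nm minm; first by rewrite leqn0 in nm; lia.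
have : ~~ (n <= tri m) by apply/negP => /minm; rewrite ltnn.
exists m, (tri m.+1 - n); have := triS m; lia.
Qed.

Lemma table_le n : n < 1100 -> let e := tab (N.of_nat n) in
  [/\ P n <= N.to_nat (pval e), Q n <= N.to_nat (qval e),
      4 * P n <= 32 + n & 4 * Q n <= 32 + n].
Proof.
move=> nN /=; have /= [[A [_ /P_le PA Ap]] [B [_ /Q_le QB Bq]]] := upper_sound nN.
have [n0|n0] := posnP n.
  have e0 : tab (N.of_nat 0) = Entry 0 0 0 0 by [].
  by move: Ap Bq PA QB; rewrite n0 e0 /= => *; split; lia.
have := @all_fromP _ _ _ (N.of_nat n) check_upper_table ltac:(lia) ltac:(lia).
by case/and5P => _ _ _ _ /and3P [_ p4 q4]; split; lia.
Qed.

(** With [m.+1 = f n] and [x = g n <= m], one step of the recursion bounds [4 * P n] and [4 * Q n]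
    by about [5 * m], while [n] is quadratic in [m]. The bound [m > 45] comes from
    [tri 46 < 1100]. *)
Lemma PQ_linear n : 4 * P n <= 32 + n /\ 4 * Q n <= 32 + n.
Proof.
elim/ltn_ind: n => n IHn; have [nN|Nn] := ltnP n 1100.
  by have [] := table_le nN.
have [|m [x [xm nx]]] := @ex_tri_root n; first by lia.
have [PnE QnE] := PQ_le_flip nx xm.
have := double_tri m.+1 => dm.
have m46 : 45 < m by nia.
have [|Px Qx] := IHn x; first by nia.
by split; nia.
Qed.

Lemma large_gap g F : 1100 <= g -> g < F ->
  [/\ tri (Q g - 3) < g + F + 1, tri (P g - 2) < g + F + 1 & Q g + 2 <= F].
Proof.
move=> Ng gF; have [|m [x [xm gx]]] := @ex_tri_root g; first by lia.
have [Pg Qg] := PQ_le_flip gx xm; have [Px Qx] := PQ_linear x.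
have := double_tri m.+1 => dm; have m46 : 45 < m by nia.
(* Both [Q g - 3] and [P g - 2] satisfy this bound on [s]. Then [tri s] is of order
   [25 * m ^ 2 / 32], while [g + F + 1] exceeds [m ^ 2]. *)
have large s : 4 * s <= 28 + 5 * m -> tri s < g + F + 1.
  move=> sm; have := double_tri s => ds.
  have : 16 * (s * s.+1) <= (28 + 5 * m) * (32 + 5 * m) by nia.
  by nia.
by split; [apply: large; lia | apply: large; lia | nia].
Qed.

Lemma nat_of_binE k : nat_of_bin k = N.to_nat k.
Proof.
by case: k => //=; elim=> //= p IHp; rewrite natTrecE IHp; lia.
Qed.

Lemma notin_exceptions n : n \notin exceptions ->
  has (N.eqb (N.of_nat n)) exceptions_bin = false.
Proof.
apply: contraNF => /hasP [k kE /N.eqb_eq nk]; apply/mapP; exists k => //.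
by rewrite nat_of_binE -nk Nat2N.id.
Qed.

(** Either the trivial bounds suffice or the computed checks apply. Volume above [tri (Q g - 3)]
    forces the complement to have perimeter at least [Q g - 1], and volume above [tri (P g - 2)]
    forces perimeter at least [P g - 1]; the missing unit comes from [k > 0]. *)
Lemma gap_cases g F : g < F -> tri F - g \notin exceptions ->
  [/\ tri (Q g - 3) < g + F + 1, tri (P g - 2) < g + F + 1 & Q g + 2 <= F] \/
  [/\ forall k B, 0 < k -> finite_set B -> vol B = g + k * F + tri k ->
        P g <= k + per B /\ Q g <= k + per (~` B)
    & Q g + 2 <= F \/
      forall k C, finite_set C -> F + k + vol C + g = tri F -> Q g <= k + per C].
Proof.
move=> gF nE; have [gN|] := ltnP g 1100; last by left; exact: large_gap.
have [] := table_le gN; set e := tab _ => Pg Qg _ _.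
set q := N.to_nat (qval e) in Qg *; set p := N.to_nat (pval e) in Pg *.
have := @all_fromP _ _ _ (N.of_nat g) check_gap_table ltac:(lia) ltac:(lia).
rewrite /check_gap -/e.
have := @triN_tri (qval e - 3) (q - 3) ltac:(lia).
have := @triN_tri (pval e - 2) (p - 2) ltac:(lia).
have [Fbig|Fsmall] := ltnP (maxn (maxn (tri (q - 3)) (tri (p - 2))) (g + q + 1)) (g + F).
  move=> _ _ _; left.
  have := @leq_tri (Q g - 3) (q - 3) ltac:(lia).
  have := @leq_tri (P g - 2) (p - 2) ltac:(lia).
  by split; lia.
move=> tp tq /all_fromP allF; right.
have {allF} : check_pair (N.of_nat g) (N.of_nat F) by apply: allF; lia.
rewrite /check_pair -/e.
have -> : (triN (N.of_nat F) - N.of_nat g)%num = N.of_nat (tri F - g).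
  by have := triN_tri (Nat2N.id F); lia.
rewrite (notin_exceptions nE) orbF => /all_fromP allk.
split=> [k B k0 finB volB|].
  have [kpq|] := ltnP k (maxn p q); last by lia.
  have /andP [+ _] := allk (N.of_nat k) ltac:(lia) ltac:(lia).
  case/orP => [|/andP []]; first by lia.
  have -> : (N.of_nat g + N.of_nat k * N.of_nat F + triN (N.of_nat k))%num =
      N.of_nat (vol B) by have := triN_tri (Nat2N.id k); lia.
  by move=> /(lower_Q_sound finB) lowq /(lower_P_sound finB) lowp; lia.
have [qF|Fq] := leqP (q + 2) F; [by left; lia | right=> k C finC volC].
have [kpq|] := ltnP k (maxn p q); last by lia.
have /andP [_ /or3P []] := allk (N.of_nat k) ltac:(lia) ltac:(lia); try lia.
have -> : (N.of_nat (tri F - g) - N.of_nat F - N.of_nat k)%num = N.of_nat (vol C) by lia.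
by move=> /(lower_P_sound finC); lia.
Qed.

Lemma shift_bound g F k B : g < F -> tri F - g \notin exceptions -> 0 < k ->
  finite_set B -> vol B = g + k * F + tri k ->
  P g <= k + per B /\ Q g <= k + per (~` B).
Proof.
move=> gF nE k0 finB volB.
have [[Qs Ps _]|[/(_ k B k0 finB volB)//]] := gap_cases gF nE.
have := double_tri k => dk.
have gB : g + F + 1 <= vol B by nia.
have [_ ltQ] := per_gt_tri finB (leq_trans Qs gB).
have [ltP _] := per_gt_tri finB (leq_trans Ps gB).
by lia.
Qed.

Lemma shift_bound_max g F k C : g < F -> tri F - g \notin exceptions ->
  finite_set C -> F + k + vol C + g = tri F -> Q g <= k + per C.
Proof.
move=> gF nE finC volC.
have [QF|] : Q g + 2 <= F \/ Q g <= k + per C.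
  have [[_ _ ?]|[_ [?|/(_ k C finC volC)]]] := gap_cases gF nE; by [left|right].
  (* If [k > F - 3], then already [k >= Q g]. Otherwise [g < F] gives [vol C > tri (F - 3)] when
     [F >= 3], so [per C >= F - 2 >= Q g]. *)
  have [kF|] := leqP k (F - 3); last by lia.
  have [F3|] := leqP 3 F; last by lia.
  have tF : tri (F - 3) + 3 * F = tri F + 3.
    rewrite -[in RHS](subnK F3).
    by have := double_tri (F - 3); have := double_tri (F - 3 + 3); nia.
  have := @per_gt_tri (F - 3) C finC ltac:(lia).
  by lia.
by [].
Qed.

Lemma PQ_recursion F g n : g < F -> n + g = tri F -> n \notin exceptions ->
  P n = F + Q g /\ Q n = F.+1 + P g.
Proof.
move=> gF nF nE; have [Pn Qn] := PQ_le_flip nF gF.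
have nE' : tri F - g \notin exceptions by rewrite (_ : tri F - g = n)//; lia.
have n0 : 0 < n by have := double_tri F; nia.
(* The maximum is at least [F]: as [g < F], [n] exceeds [tri F.-1], the volume of everything below
   [F]. *)
have maxE A m : has_vol A n -> A `<=` `I_m.+1 -> A m -> exists k, m = F + k.
  move=> An Am mA; have [B [volB _ _ _]] := flip_decomp Am mA.
  exists (m - F); rewrite subnKC// leqNgt; apply/negP => mF.
  have := @leq_tri m F.-1 ltac:(lia); have := triS F.-1.
  by rewrite prednK; [case: An => _; lia | lia].
split; apply/eqP; rewrite eqn_leq ?Pn ?Qn /=.
  have [A An <-] := P_attained n; have [finA volA] := An.
  have [|m Am mA] := ex_max finA; first by rewrite volA.
  have [k mE] := maxE _ _ An Am mA; rewrite {}mE in Am mA.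
  have [B [volB Bm _ perA]] := flip_decomp Am mA.
  have finB := finite_below Bm.
  have tk := triD F k.
  case: perA => [perA|[C [Cm volC ->]]]; last first.
    have := @shift_bound_max g F k C gF nE' (finite_below Cm) ltac:(lia).
    by lia.
  (* For [k = 0] the set [B] has volume [g], and [Q g] bounds the perimeter of its complement by
     definition. For [k > 0] its volume is [g + k * F + tri k]. *)
  apply: leq_trans perA; have [k0|k0] := posnP k.
    have := Q_le (conj finB erefl); rewrite k0 (_ : vol B = g)//; try lia.
    by move: tk volB; rewrite k0; have := double_tri 0; lia.
  have [|_] := @shift_bound g F k B gF nE' k0 finB; last by lia.
  by lia.
have [A An <-] := Q_attained n; have [finA volA] := An.
have [|m Am mA] := ex_max finA; first by rewrite volA.
have [k mE] := maxE _ _ An Am mA; rewrite {}mE in Am mA.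
have [B [volB Bm -> _]] := flip_decomp Am mA.
have finB := finite_below Bm.
have tk := triD F k.
have [k0|k0] := posnP k.
  have := P_le (conj finB erefl); rewrite k0 (_ : vol B = g)//; try lia.
  by move: tk volB; rewrite k0; have := double_tri 0; lia.
have [|+ _] := @shift_bound g F k B gF nE' k0 finB; last by lia.
by lia.
Qed.

(** * The functions f and g in terms of triangular numbers *)

Lemma sum_tri m : \sum_(1 <= i < m.+1) i = tri m.
Proof.
elim: m => [|m IHm]; first by rewrite big_geq.
by rewrite triS big_nat_recr//= IHm.
Qed.

(** Squaring [F - 1/2 <= sqrt (2n) < F + 1/2] leaves an error of [1/4], which integrality absorbs.
    Thus [f n] is the least [a] with [n <= tri a]. *)
Lemma f_tri (R : realType) n : n <= tri (f R n) /\ (0 < f R n -> tri (f R n).-1 < n).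
Proof.
rewrite /f; set x := (Num.sqrt _ + _)%R.
have x0 : (0 <= x)%R by rewrite addr_ge0// ?sqrtr_ge0// divr_ge0.
have sq : (Num.sqrt (2 * n)%N%:R ^+ 2 = (2 * n)%N%:R :> R)%R by rewrite sqr_sqrtr.
have s0 := sqrtr_ge0 ((2 * n)%N%:R : R)%R.
have /andP [] := truncn_itv x0; move: (Num.truncn x) => F.
rewrite {x0}/x; move: (Num.sqrt _) sq s0 => s sq s0 Fs sF.
split.
  have : ((2 * n)%N%:R < (F * F.+1 + 1)%N%:R :> R)%R.
    move: sF; rewrite -sq natrD natrM -[F.+1%:R%R]natr1.
    move: (F%:R : R)%R (ler0n R F) => r r0 sr.
    have : (0 < (r + 1 / 2 - s) * (r + 1 / 2 + s))%R by apply: mulr_gt0; lra.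
    by lra.
  by rewrite ltr_nat; have := double_tri F; lia.
case: F Fs {sF} => // F Fs _; rewrite -pred_Sn.
have : ((F * F.+1)%N%:R < (2 * n)%N%:R :> R)%R.
  move: Fs; rewrite -sq natrM -[F.+1%:R%R]natr1.
  move: (F%:R : R)%R (ler0n R F) => r r0 sr.
  have : (0 <= (s - r - 1 / 2) * (s + r + 1 / 2))%R by apply: mulr_ge0; lra.
  by lra.
by rewrite ltr_nat; have := double_tri F; lia.
Qed.

Lemma f_le (R : realType) n a : n <= tri a -> f R n <= a.
Proof.
move=> na; rewrite leqNgt; apply/negP => af.
have := (f_tri R n).2 (leq_ltn_trans (leq0n a) af).
by have := @leq_tri a (f R n).-1 ltac:(lia); lia.
Qed.

Lemma g_tri (R : realType) n : n + g R n = tri (f R n).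
Proof.
have [nF _] := f_tri R n; rewrite /g addn1 divn2 -/(tri _); lia.
Qed.

Theorem theorem18 (R : realType) (n : nat) :
  [/\ (n \notin exceptions ->
        P n = (f R n + Q (g R n))%N /\ Q n = (1 + f R n + P (g R n))%N),
      ((nat_of_bin 149894%num < n)%N -> n \notin exceptions),
      ((\sum_(1 <= i < (f R n).+1) i)%N%:Z - (g R n)%:Z = n%:Z)%R
    & forall a b : nat,
        ((\sum_(1 <= i < a.+1) i)%N%:Z - b%:Z = n%:Z)%R ->
        (f R n <= a)%N /\ (g R n <= b)%N].
Proof.
have [_ Fn] := f_tri R n; have gE := g_tri R n.
split.
- move=> nE; apply: PQ_recursion => //.
  (* As [0] is an exception, [n] is positive; then [tri (f n - 1) < n] gives [g n < f n]. *)
  have n0 : 0 < n by case: (n) nE.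
  have F0 : 0 < f R n by rewrite lt0n; apply/eqP => F0; have := double_tri 0; rewrite F0 in gE; lia.
  by have := triS (f R n).-1; rewrite prednK//; have := Fn F0; lia.
- rewrite nat_of_binE => nbig; apply/mapP => -[k kE nk].
  have /allP /(_ k kE) : all (N.leb^~ 149894%num) exceptions_bin by vm_compute.
  by rewrite nk nat_of_binE in nbig; lia.
- by rewrite sum_tri -gE; lia.
- move=> a b; rewrite sum_tri => ab.
  have na : n <= tri a by lia.
  (* The least [b] goes with the least [a], since [b = tri a - n] and [tri] is monotone. *)
  have fa := f_le R na; have := leq_tri fa; lia.
Qed.
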